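(* Let $d\in\mathbb{N}$, $\delta>0$, and let $\{\phi_{\boldsymbol n}\}$ be the tensorial piecewise linear finite element basis on the uniform grid of mesh size $h$ described in the context. Then the entries of the nonlocal stiffness matrix $\boldsymbol S_\delta\in\mathbb{R}^{N_*\times N_*}$, $N_*=\prod_{j=1}^d N_j$, are given by $$(\boldsymbol S_\delta)_{ll'}=\mathcal{A}_\delta(\phi_{\boldsymbol n},\phi_{\boldsymbol m})=\frac{h^d}{2}\int_{\mathbb{B}^d_\delta} f_{\boldsymbol k}(\boldsymbol s)\,\rho_\delta(|\boldsymbol s|)\,\mathrm{d}\boldsymbol s,$$ where $$f_{\boldsymbol k}(\boldsymbol s)=2\prod_{j=1}^d B_3(k_j+2)-\prod_{j=1}^d B_3(k_j+2-s_j/h)-\prod_{j=1}^d B_3(k_j+2+s_j/h),$$ with $\boldsymbol k=(k_1,\dots,k_d)$, $k_j=|n_j-m_j|$, and the local-to-global indices $$l=\sum_{i=1}^d (n_i-1)\Big(\prod_{j=1}^{i-1}N_j\Big)+1,\qquad l'=\sum_{i=1}^d (m_i-1)\Big(\prod_{j=1}^{i-1}N_j\Big)+1,$$ for $1\le n_j,m_j\le N_j$, $1\le j\le d$.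
   Context: Domain and grid: $\Omega=(a_1,b_1)\times\cdots\times(a_d,b_d)\subset\mathbb{R}^d$ and $\widetilde\Omega=(a_1-\delta,b_1+\delta)\times\cdots\times(a_d-\delta,b_d+\delta)$. For each $j$, let $N_j\ge1$ be an integer, $h_j=(b_j-a_j)/(N_j+1)$, and assume $h_1=\cdots=h_d=h$. Grid points are $\xi_{j,n_j}=a_j+n_jh$, $0\le n_j\le N_j+1$. Basis: for $1\le n_j\le N_j$, $\phi_{n_j}(x_j)$ is the hat function equal to $(x_j-\xi_{j,n_j-1})/h$ on $(\xi_{j,n_j-1},\xi_{j,n_j})$, equal to $(\xi_{j,n_j+1}-x_j)/h$ on $(\xi_{j,n_j},\xi_{j,n_j+1})$ (value $1$ at $\xi_{j,n_j}$), and zero elsewhere (extended by zero to all of $\mathbb{R}$). For $\boldsymbol n=(n_1,\dots,n_d)$, $\phi_{\boldsymbol n}(\boldsymbol x)=\prod_{j=1}^d\phi_{n_j}(x_j)$. Kernel: $\mathbb{B}^d_\delta$ is the ball of radius $\delta$ centered at $0$ in $\mathbb{R}^d$; $\rho_\delta(|\boldsymbol s|)$ is a radial kernel, non-increasing in $|\boldsymbol s|$, with $\int_{\mathbb{B}^d_\delta}\rho_\delta(|\boldsymbol s|)|\boldsymbol s|^2\,\mathrm{d}\boldsymbol s=d$. Bilinear form: $$\mathcal{A}_\delta(u,v)=\frac12\int_{\widetilde\Omega}\int_{\mathbb{B}^d_\delta}(u(\boldsymbol x+\boldsymbol s)-u(\boldsymbol x))(v(\boldsymbol x+\boldsymbol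 s)-v(\boldsymbol x))\rho_\delta(|\boldsymbol s|)\,\mathrm{d}\boldsymbol s\,\mathrm{d}\boldsymbol x.$$ The stiffness matrix $\boldsymbol S_\delta$ has entries $(\boldsymbol S_\delta)_{ll'}=\mathcal{A}_\delta(\phi_{\boldsymbol n},\phi_{\boldsymbol m})$, with $l,l'$ the global indices of $\boldsymbol n,\boldsymbol m$. Cubic B-spline: $B_3(t)=t^3/6$ on $[0,1)$; $-t^3/2+2t^2-2t+2/3$ on $[1,2)$; $t^3/2-4t^2+10t-22/3$ on $[2,3)$; $-(t-4)^3/6$ on $[3,4)$; $0$ elsewhere. *)

(* Defs.v *)
From HB Require Import structures.
From mathcomp Require Import all_boot all_order all_algebra.
From mathcomp Require Import all_classical all_reals all_analysis.

Set Implicit Arguments.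
Unset Strict Implicit.
Unset Printing Implicit Defensive.

Import Order.TTheory GRing.Theory Num.Theory.
Import numFieldNormedType.Exports.

Local Open Scope classical_set_scope.
Local Open Scope ring_scope.

(* A point of R^d is a [d.-tuple R], because the
   library equips tuples with the product sigma-algebra; its coordinates are
   indexed from 0, by ['I_d]. *)

(* The library has no Lebesgue measure on R^d.  It is built here as the d-fold
   product of the one-dimensional one, transported along the isomorphism
   R * R^n -> R^n.+1. *)
Section cons_measure.
Context (R : realType) (n : nat).
Variable mu : {sigma_finite_measure set (n.-tuple (measurableTypeR R)) -> \bar R}.

Definition tcons (p : measurableTypeR R * n.-tuple (measurableTypeR R)) :
  n.+1.-tuple (measurableTypeR R) := [the n.+1.-tuple _ of p.1 :: p.2].

Definition tuncons (t : n.+1.-tuple (measurableTypeR R)) :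
  measurableTypeR R * n.-tuple (measurableTypeR R) :=
  (tnth t ord0, [tuple of behead t]).

Lemma tconsK : cancel tcons tuncons.
Proof.
case=> x y; rewrite /tuncons /tcons /=; congr pair; exact/val_inj.
Qed.

Lemma measurable_tcons : measurable_fun setT tcons.
Proof. exact: measurable_cons measurable_fst measurable_snd. Qed.

Lemma measurable_tuncons : measurable_fun setT tuncons.
Proof.
apply/measurable_fun_pairP; split => /=; first exact: measurable_tnth.
exact: measurable_behead.
Qed.

Definition cons_measure : set (n.+1.-tuple (measurableTypeR R)) -> \bar R :=
  pushforward (@lebesgue_measure R \x mu)%E tcons.

Let cons_measure0 : cons_measure set0 = 0%E.
Proof. by rewrite /cons_measure /pushforward preimage_set0 measure0. Qed.

Let cons_measure_ge0 A : (0 <= cons_measure A)%E.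
Proof. by rewrite /cons_measure /pushforward measure_ge0. Qed.

Let cons_measure_sigma_additive : semi_sigma_additive cons_measure.
Proof.
have mcons A : measurable A -> measurable (tcons @^-1` A).
  by move=> mA; rewrite -[X in measurable X]setTI; exact: measurable_tcons.
move=> F mF tF mUF; rewrite /cons_measure /pushforward preimage_bigcup.
apply: measure_semi_sigma_additive.
- by move=> k; exact: mcons.
- apply/trivIsetP => /= i j _ _ ij; rewrite -preimage_setI.
  by move/trivIsetP : tF => /(_ _ _ _ _ ij) ->//; rewrite preimage_set0.
- by rewrite -preimage_bigcup; exact: mcons.
Qed.

HB.instance Definition _ := isMeasure.Build _ _ _ cons_measure
  cons_measure0 cons_measure_ge0 cons_measure_sigma_additive.

Let cons_measure_sigma_finite : sigma_finite setT cons_measure.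
Proof.
have /sigma_finiteP[F [TF ndF Foo]] := sigma_finiteT (@lebesgue_measure R).
have /sigma_finiteP[G [TG ndG Goo]] := sigma_finiteT mu.
exists (fun k => tuncons @^-1` (F k `*` G k)).
  rewrite -preimage_bigcup (_ : \bigcup_k _ = setT) ?preimage_setT//.
  rewrite -setXTT TF TG predeqE => -[x y]; split.
    by move=> [k _ []/= ? ?]; split; exists k.
  move=> [/= [i _ Fix] [k _ Gky]]; exists (maxn i k) => //; split.
  - by move: x Fix; exact/subsetPset/ndF/leq_maxl.
  - by move: y Gky; exact/subsetPset/ndG/leq_maxr.
move=> k; have [mF Foo'] := Foo k; have [mG Goo'] := Goo k.
have mFG : measurable (F k `*` G k) by exact: measurableX.
split.
  by rewrite -[X in measurable X]setTI; exact: measurable_tuncons.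
rewrite /cons_measure /pushforward -comp_preimage.
rewrite (_ : tuncons \o tcons = id) ?preimage_id//.
  by rewrite product_measure1E// lte_mul_pinfty// ge0_fin_numE.
by apply/funext => p /=; rewrite tconsK.
Qed.

HB.instance Definition _ := Measure_isSigmaFinite.Build _ _ _ cons_measure
  cons_measure_sigma_finite.

End cons_measure.

Fixpoint lebesgueRd (R : realType) (d : nat) :
    {sigma_finite_measure set (d.-tuple (measurableTypeR R)) -> \bar R} :=
  match d with
  | 0 => \d_([tuple] : 0.-tuple (measurableTypeR R))
  | n.+1 => cons_measure (lebesgueRd R n)
  end.

Lemma lebesgueRd_box (R : realType) (d : nat) (A : 'I_d -> set (measurableTypeR R)) :
  (forall j, measurable (A j)) ->
  lebesgueRd R d [set x | forall j, A j (tnth x j)] =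
    (\prod_(j < d) lebesgue_measure (A j))%E.
Proof.
elim: d A => [|d IH] A mA /=.
  by rewrite big_ord0 diracE mem_set//= => -[].
rewrite big_ord_recl /cons_measure /pushforward.
rewrite -(IH (A \o lift ord0)) //; last by move=> j; exact: mA.
rewrite -product_measure1E//; last first.
  rewrite (_ : mkset _ =
      \bigcap_(j in [set` [set: 'I_d]%SET]) ((tnth (T:=_))^~ j @^-1` A (lift ord0 j))).
    apply: fin_bigcap_measurable => // j _.
    by rewrite -[X in measurable X]setTI; exact: measurable_tnth.
  apply/seteqP; split => x /= Ax j => [_|]; first exact: Ax.
  by apply: Ax; rewrite /= inE.
congr (_ _); apply/seteqP; split => -[x y] /=.
  move=> H; split; first by have := H ord0.
  by move=> j; have := H (lift ord0 j); rewrite tnthS.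
by move=> [Ax Ay] j; case: (unliftP ord0 j) => [i|] -> //=; rewrite tnthS.
Qed.

Section nonlocal_stiffness.
Context (R : realType).

Section geometry.
Context (d : nat).
Local Notation Rd := (d.-tuple (measurableTypeR R)).

Definition tadd (x s : Rd) : Rd := [tuple (tnth x j + tnth s j : R) | j < d].

Definition enorm (s : Rd) : R := Num.sqrt (\sum_(j < d) (tnth s j : R) ^+ 2).

Definition eball (delta : R) : set Rd := [set s | enorm s < delta].

(* Omega-tilde, the box Omega enlarged by delta on every side *)
Definition enlarged_box (a b : 'I_d -> R) (delta : R) : set Rd :=
  [set x | forall j, a j - delta < tnth x j < b j + delta].

End geometry.

Definition grid_point (a h : R) (i : nat) : R := a + i%:R * h.

(* The first branch includes the node [grid_point a h i], where it is 1. *)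
Definition hat (a h : R) (i : nat) (t : R) : R :=
  if grid_point a h i.-1 < t <= grid_point a h i then
    (t - grid_point a h i.-1) / h
  else if grid_point a h i < t < grid_point a h i.+1 then
    (grid_point a h i.+1 - t) / h
  else 0.

Definition fe_basis (d : nat) (a : 'I_d -> R) (h : R) (n : 'I_d -> nat)
    (x : d.-tuple (measurableTypeR R)) : R :=
  \prod_(j < d) hat (a j) h (n j) (tnth x j).

(* Extended-real valued, so that an equality with a real number also carries
   the convergence of the integral. *)
Definition nonlocal_form (d : nat) (a b : 'I_d -> R) (delta : R) (rho : R -> R)
    (u v : d.-tuple (measurableTypeR R) -> R) : \bar R :=
  ((2^-1)%:E *
   \int[lebesgueRd R d]_(x in enlarged_box a b delta)
     \int[lebesgueRd R d]_(s in eball delta)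
       ((u (tadd x s) - u x) * (v (tadd x s) - v x) * rho (enorm s))%:E)%E.

(* Only the values of rho on (0, delta) are constrained: rho may blow up at 0
   and its value at 0 is irrelevant.  The moment is an extended-real integral,
   so its being d makes rho(|s|)|s|^2 integrable. *)
Definition admissible_kernel (d : nat) (delta : R) (rho : R -> R) : Prop :=
  {in `]0, delta[ &, {homo rho : r t /~ r <= t}} /\
  (\int[lebesgueRd R d]_(s in eball delta)
     (rho (enorm s) * enorm s ^+ 2)%:E = d%:R%:E)%E.

End nonlocal_stiffness.

Section indices.
Context (d : nat) (N : 'I_d -> nat).

Definition multi_index (n : 'I_d -> nat) : Prop :=
  forall j, (1 <= n j <= N j)%N.

Definition global_index (n : 'I_d -> nat) : nat :=
  (\sum_(i < d) (n i - 1) * \prod_(j < d | j < i) N j + 1)%N.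

(* Mixed-radix digits: the inverse of [global_index], for l counted from 0. *)
Definition local_index (l : nat) (j : 'I_d) : nat :=
  (l %/ \prod_(i < d | i < j) N i %% N j + 1)%N.

End indices.

Lemma global_index_lt (d : nat) (N n : 'I_d -> nat) :
  multi_index N n -> ((global_index N n).-1 < \prod_(j < d) N j)%N.
Proof.
rewrite /global_index addn1 /=.
elim: d N n => [|d IH] N n Hn; first by rewrite !big_ord0.
rewrite !big_ord_recr /=.
have := IH (N \o widen_ord (leqnSn d)) (n \o widen_ord (leqnSn d))
  (fun j => Hn (widen_ord (leqnSn d) j)).
rewrite /= => Hlt.
rewrite (eq_bigr (fun i : 'I_d => (n (widen_ord (leqnSn d) i) - 1) *
    \prod_(j < d | (j < i)%N) N (widen_ord (leqnSn d) j))%N); last first.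
  move=> i _; congr (_ * _)%N.
  by rewrite big_mkcond big_ord_recr /= ltnNge ltnW//= muln1 -big_mkcond.
rewrite [X in (_ * X)%N](_ : _ = \prod_(j < d) N (widen_ord (leqnSn d) j))%N;
  last first.
  rewrite big_mkcond big_ord_recr /= ltnn muln1.
  by apply: eq_bigr => i _; rewrite ltn_ord.
move: Hlt; set P := (\prod_(j < d) _)%N; set S := (\sum_(i < d) _)%N => Hlt.
have /andP[n1 nN] := Hn ord_max.
rewrite -(subnK (leq_trans n1 nN)) mulnDr muln1 addnC mulnC.
by rewrite -addnS leq_add// leq_mul// leq_sub2r.
Qed.

(* Rows and columns of a matrix are counted from 0, global indices from 1. *)
Definition global_ord (d : nat) (N n : 'I_d -> nat) (hn : multi_index N n) :
  'I_(\prod_(j < d) N j) := Ordinal (global_index_lt hn).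

Definition stiffness (R : realType) (d : nat) (a b : 'I_d -> R)
    (N : 'I_d -> nat) (h delta : R) (rho : R -> R) :
    'M[R]_(\prod_(j < d) N j) :=
  \matrix_(l, l') fine (nonlocal_form a b delta rho
    (fe_basis a h (local_index N l)) (fe_basis a h (local_index N l'))).

Definition B3 (R : realType) (t : R) : R :=
  if 0 <= t < 1 then t ^+ 3 / 6
  else if 1 <= t < 2 then - t ^+ 3 / 2 + 2 * t ^+ 2 - 2 * t + 2 / 3
  else if 2 <= t < 3 then t ^+ 3 / 2 - 4 * t ^+ 2 + 10 * t - 22 / 3
  else if 3 <= t < 4 then - (t - 4) ^+ 3 / 6
  else 0.

Definition f_spline (R : realType) (d : nat) (h : R) (k : 'I_d -> nat)
    (s : d.-tuple (measurableTypeR R)) : R :=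
  2 * \prod_(j < d) B3 ((k j)%:R + 2)
  - \prod_(j < d) B3 ((k j)%:R + 2 - tnth s j / h)
  - \prod_(j < d) B3 ((k j)%:R + 2 + tnth s j / h).

(* Main.v *)
Require Import Defs.
From HB Require Import structures.
From mathcomp Require Import all_boot all_order all_algebra.
From mathcomp Require Import all_classical all_reals all_analysis.
From mathcomp Require Import measurable_realfun ring lra.

Set Implicit Arguments.
Unset Strict Implicit.
Unset Printing Implicit Defensive.

Import Order.TTheory GRing.Theory Num.Theory.
Import numFieldNormedType.Exports.

Local Open Scope classical_set_scope.
Local Open Scope ring_scope.

(** Expanding the product of the two increments under the integral, the form
    becomes, after an exchange of the order of integration, the kernel-weighted
    integral over [s] of

      [\int (phi_n (x + s) - phi_n x) * (phi_m (x + s) - phi_m x) dx].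

    Since a basis function vanishes outside of the box Omega, restricting [x] to
    the box enlarged by [delta] changes nothing for [s] in the ball of radius
    [delta], and the inner integral may be taken over the whole space.  It is
    the sum of four integrals of products of two tensorial hat functions with
    arbitrary centres, and each of these factors into one-dimensional integrals.
    In one dimension the integral of two tents of half-width [h] centred at [c]
    and [c'] is [h * B3 (2 + (c - c') / h)]: pairing a tent with a function is
    taking a second difference of a second antiderivative, and the second
    antiderivative of the other tent is a second difference of truncated cubes,
    so the outcome is the fourth difference that defines the cubic B-spline
    ([integral_tent_mul], [integral_tent_tent]).  Centres [n] and [m] thus give

      [2 * \prod_j B3 (2 + (n_j - m_j)) - \prod_j B3 (2 + (n_j - m_j) - s_j / h)
       - \prod_j B3 (2 + (n_j - m_j) + s_j / h)]

    times [h ^+ d] ([integral_tents_increments]).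

    This is the function [f_spline] of the theorem only when all the
    differences [n_j - m_j] are nonnegative.  In general the symmetry of [B3]
    about 2 turns it into [f_spline] evaluated at the point obtained from [s] by
    changing the sign of the coordinates where [n_j < m_j]
    ([f_spline_reflect]); the two functions differ pointwise, but the ball, the
    radial kernel and Lebesgue measure are invariant under such a reflection
    ([integral_reflect]), so the integrals agree.

    The exchange of integrals needs absolute integrability
    ([integrable_increments]): the hat functions are Lipschitz, so the product
    of the increments is at most a constant times [|s|^2], and [rho |s|^2] is
    absolutely integrable because its integral is finite.  The value of the
    kernel at the origin is unconstrained, but every integrand carries a factor
    that vanishes at [s = 0].

    The entries of the matrix, defined by decoding row and column numbers, are
    those of the multi-indices [n] and [m] because decoding inverts the global
    numbering ([local_global_index]). *)

(** * Mixed-radix indices *)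

Section indices.

(** Induction on the number of digits: the weight of the top digit is the
    product [P] of all lower radices, which exceeds the contribution [S] of the
    lower digits and is a multiple of every lower weight times its radix. *)
Lemma local_global_index (d : nat) (N n : 'I_d -> nat) :
  multi_index N n -> local_index N (global_index N n).-1 = n.
Proof.
move=> Hn; apply/funext => j; move: d N n Hn j.
elim=> [|d IH] N n Hn j; first by case: j.
have Hn' : multi_index (N \o widen_ord (leqnSn d)) (n \o widen_ord (leqnSn d)).
  by move=> i; exact: Hn.
have := global_index_lt Hn'.
have := IH _ _ Hn'.
rewrite /local_index /global_index !addn1 /=.
rewrite [X in ((X %/ _) %% _).+1](_ : _ =
  \sum_(i < d) (n (widen_ord (leqnSn d) i) - 1)
     * \prod_(j < d | (j < i)%N) N (widen_ord (leqnSn d) j)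
  + (n ord_max - 1) * \prod_(j < d) N (widen_ord (leqnSn d) j))%N; last first.
  rewrite big_ord_recr /=; congr (_ + _ * _)%N.
    apply: eq_bigr => i _; congr (_ * _)%N.
    by rewrite big_mkcond big_ord_recr /= ltnNge ltnW//= muln1 -big_mkcond.
  rewrite big_mkcond big_ord_recr /= ltnn muln1.
  by apply: eq_bigr => i _; rewrite ltn_ord.
set S := (\sum_(i < d) _)%N; set P := (\prod_(i < d) _)%N => IHj SP.
have P0 : (0 < P)%N by exact: leq_ltn_trans SP.
case: (unliftP ord_max j) => [i ->|->].
  have -> : lift ord_max i = widen_ord (leqnSn d) i.
    by apply/val_inj; rewrite /= /bump leqNgt ltn_ord.
  have /= <- := IHj i.
  rewrite (_ : (\prod_(i0 < d.+1 | _) _) =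
    \prod_(i0 < d | (i0 < i)%N) N (widen_ord (leqnSn d) i0))%N; last first.
    rewrite big_mkcond big_ord_recr /= ltnNge (ltnW (ltn_ord i)) /= muln1.
    by rewrite -big_mkcond.
  set Q := (\prod_(i0 < d | _) _)%N.
  have QNP : (Q * N (widen_ord (leqnSn d) i) %| P)%N.
    rewrite /P (bigID (fun i0 : 'I_d => (i0 < i)%N)) /= dvdn_pmul2l; last first.
      by apply: prodn_cond_gt0 => i0 _; have /andP[n1 nN] := Hn' i0;
        exact: leq_trans n1 nN.
    by rewrite (bigD1 i) ?ltnn//= dvdn_mulr.
  case/dvdnP: QNP => q ->; rewrite divnDr; last first.
    by rewrite (mulnC Q) 2!mulnA dvdn_mull.
  have Q0 : (0 < Q)%N.
    by apply: prodn_cond_gt0 => i0 _; have /andP[n1 nN] := Hn' i0;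
        exact: leq_trans n1 nN.
  rewrite (mulnC Q) 2!mulnA mulnK// -modnDmr.
  by rewrite modnMl addn0 addn1.
rewrite (_ : (\prod_(i0 < d.+1 | _) _) = P)%N; last first.
  rewrite big_mkcond big_ord_recr /= ltnn muln1.
  by apply: eq_bigr => i _; rewrite ltn_ord.
rewrite addnC divnMDl// divn_small// addn0.
have /andP[n1 nN] := Hn ord_max.
by rewrite modn_small ?subn1 ?prednK.
Qed.

End indices.

(** * Tent functions and the cubic B-spline *)

Section tent.
Context (R : realType).
Implicit Types (c h t x y w : R).

(** The truncated power [x_+^n] of spline theory. *)
Definition posp (n : nat) (x : R) : R := Num.max 0 x ^+ n.

Lemma pospE n x : posp n.+1 x = if 0 <= x then x ^+ n.+1 else 0.
Proof.
rewrite /posp; case: ifPn => [x0|]; first by rewrite max_r.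
by rewrite -ltNge => x0; rewrite max_l ?expr0n// ltW.
Qed.

Lemma pospZ n a x : 0 < a -> posp n.+1 (a * x) = a ^+ n.+1 * posp n.+1 x.
Proof.
move=> a0; rewrite !pospE pmulr_rge0//; case: ifP => _; last by rewrite mulr0.
by rewrite exprMn.
Qed.

(** Truncated powers have a knot at the origin; a remainder estimate that is
    uniform in the base point avoids separate arguments on the two sides. *)
Lemma is_derive_of_quadratic_remainder (f : R -> R) (x l : R) :
  (forall k, `|f (x + k) - f x - l * k| <= k ^+ 2) -> is_derive x 1 f l.
Proof.
move=> H.
have cv : (fun k => k^-1 *: ((f \o shift x) (k *: 1) - f x)) @ 0^' --> l.
  apply/cvgrPdist_le => e e0; near=> k.
  have k0 : k != 0 by near: k; exact: nbhs_dnbhs_neq.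
  rewrite /= /GRing.scale /= mulr1 [k + x]addrC.
  rewrite (_ : _ - _ = - (k^-1 * (f (x + k) - f x - l * k))); last by field.
  rewrite normrN normrM.
  apply: (@le_trans _ _ (`|k^-1| * k ^+ 2)); first by rewrite ler_wpM2l.
  rewrite -(real_normK (num_real k)) normfV expr2 mulrA mulVf ?normr_eq0// mul1r.
  by near: k; apply: dnbhs0_le.
apply: DeriveDef; first by apply/cvg_ex; exists l.
by rewrite /derive; apply/cvg_lim.
Unshelve. all: by end_near.
Qed.

Lemma is_derive_posp2 x : is_derive x 1 (posp 2) (2 * posp 1 x).
Proof.
apply: is_derive_of_quadratic_remainder => k.
by rewrite !pospE ler_norml; case: ifPn; case: ifPn; rewrite -?ltNge => ? ?;
  apply/andP; split; nra.
Qed.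

Lemma is_derive_posp3 x : is_derive x 1 (posp 3) (3 * posp 2 x).
Proof.
have D : is_derive x 1 (fun y => y * posp 2 y)
    (x *: (2 * posp 1 x) + posp 2 x *: 1).
  exact: (is_deriveM (is_derive_id x 1) (is_derive_posp2 x)).
have -> : posp 3 = (fun y => y * posp 2 y).
  by apply/funext => y; rewrite !pospE; case: ifP; rewrite ?mulr0// => _; ring.
apply: is_derive_eq D _; rewrite /GRing.scale /= !pospE; case: ifP => _; ring.
Qed.

(** Unlike [hat], whose centre is a grid node, a tent may be centred at any
    point, so that this family is stable under translation. *)
Definition tent c h t : R := Num.max 0 (1 - `|t - c| / h).

Lemma hat_tent (a h : R) (i : nat) t : 0 < h -> (0 < i)%N ->
  hat a h i t = tent (grid_point a h i) h t.
Proof.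
move=> h0 i0; rewrite /hat /tent; case: i i0 => // i _ /=.
have -> : grid_point a h i = grid_point a h i.+1 - h.
  by rewrite /grid_point -natr1; ring.
have -> : grid_point a h i.+2 = grid_point a h i.+1 + h.
  by rewrite /grid_point -[i.+2%:R]natr1; ring.
set c := grid_point a h i.+1.
have E u : (0 <= 1 - u / h) = (u <= h) by rewrite subr_ge0 ler_pdivrMr// mul1r.
case: ifPn => [/andP[t1 t2]|H1].
  rewrite ler0_norm ?subr_le0// max_r ?E; last lra.
  by field; rewrite gt_eqF.
case: ifPn => [/andP[t1 t2]|H2].
  rewrite gtr0_norm ?subr_gt0// max_r ?E; last lra.
  by field; rewrite gt_eqF.
rewrite max_l// subr_le0 ler_pdivlMr// mul1r.
move: H1 H2; rewrite !negb_and -!ltNge -!leNgt => /orP[H1|H1] /orP[H2|H2].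
- by rewrite ler0_norm; lra.
- lra.
- lra.
- by rewrite ger0_norm; lra.
Qed.

Lemma tent_ge0 c h t : 0 <= tent c h t. Proof. by rewrite le_max lexx. Qed.

Lemma tent_le1 c h t : 0 < h -> tent c h t <= 1.
Proof.
by move=> h0; rewrite ge_max ler01 gerBl divr_ge0// ltW.
Qed.

Lemma tent_eq0 c h t : 0 < h -> h <= `|t - c| -> tent c h t = 0.
Proof.
by move=> h0 H; rewrite /tent max_l// subr_le0 ler_pdivlMr// mul1r.
Qed.

Lemma tent_shift c h t s : tent c h (t + s) = tent (c - s) h t.
Proof. by rewrite /tent opprB addrA. Qed.

Lemma tent_lipschitz c h t s : 0 < h ->
  `|tent c h t - tent c h s| <= `|t - s| / h.
Proof.
move=> h0.
have H x y : tent c h x <= tent c h y + `|x - y| / h.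
  rewrite ge_max addr_ge0 ?tent_ge0 ?divr_ge0// ?(ltW h0)//=.
  rewrite -lerBlDr le_max; apply/orP; right.
  have /(ler_wpM2r (ltW (_ : 0 < h^-1))) : `|y - c| <= `|x - y| + `|x - c|.
    by rewrite (distrC x y); exact: ler_distD.
  by rewrite invr_gt0 mulrDl => /(_ h0); lra.
rewrite ler_norml lerBlDl H andbT lerNl opprB lerBlDl.
by rewrite (le_trans (H s t))// distrC.
Qed.

Lemma continuous_tent c h : continuous (tent c h).
Proof.
move=> x; apply: (@continuous_max _ _ (cst 0) (fun y => 1 - `|y - c| / h) x);
  first exact: cvg_cst.
apply: cvgB; first exact: cvg_cst.
apply: cvgM; last exact: cvg_cst.
by apply: cvg_norm; apply: cvgB; [exact: cvg_id|exact: cvg_cst].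
Qed.

Lemma measurable_tent c h : measurable_fun setT (tent c h).
Proof. by apply: continuous_measurable_fun; exact: continuous_tent. Qed.

(** A tent is a second difference of truncated first powers, so two
    integrations turn it into a second difference of truncated cubes. *)
Lemma tent_posp c h t : 0 < h ->
  tent c h t = (posp 1 (t - c + h) - 2 * posp 1 (t - c) + posp 1 (t - c - h)) / h.
Proof.
move=> h0; rewrite !pospE !expr1 /tent.
have E u : 0 < h - u -> Num.max 0 (1 - u / h) = (h - u) / h.
  move=> H; rewrite mulrBl mulfV ?gt_eqF// max_r//.
  by rewrite subr_ge0 ler_pdivrMr//; lra.
have E0 u : h <= u -> Num.max 0 (1 - u / h) = 0.
  by move=> H; rewrite max_l// subr_le0 ler_pdivlMr// mul1r.
have [H|H] := leP 0 (t - c).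
  have -> : 0 <= t - c + h by lra.
  rewrite (ger0_norm H).
  have [H'|H'] := leP 0 (t - c - h); [rewrite E0; last lra|rewrite E; last lra].
    by rewrite (_ : _ + _ = 0) ?mul0r//; ring.
  by congr (_ / _); ring.
have -> : (0 <= t - c - h) = false by apply/negbTE; rewrite -ltNge; lra.
rewrite (ltr0_norm H) mulr0 subr0 addr0.
have [H'|H'] := leP 0 (t - c + h); last by rewrite E0 ?mul0r//; lra.
have [H0|H0] := eqVneq (t - c + h) 0; first by rewrite H0 mul0r E0//; lra.
rewrite E; first by congr (_ / _); ring.
by rewrite lt_neqAle eq_sym (_ : h - - (t - c) = t - c + h) ?H0//; ring.
Qed.

Lemma B3_posp x : B3 x = (posp 3 x - 4 * posp 3 (x - 1) + 6 * posp 3 (x - 2)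
  - 4 * posp 3 (x - 3) + posp 3 (x - 4)) / 6.
Proof.
rewrite /B3 !pospE !subr_ge0.
have [x0|x0] /= := leP 0 x; last first.
  have F y : 0 <= y -> (y <= x) = false
    by move=> ?; apply/negbTE; rewrite -ltNge; lra.
  by rewrite !F ?ler0n//=; lra.
have [x1|x1] /= := ltP x 1.
  have F y : 1 <= y -> (y <= x) = false
    by move=> ?; apply/negbTE; rewrite -ltNge; lra.
  by rewrite !F ?ler1n//=; lra.
have [x2|x2] /= := ltP x 2.
  have F y : 2 <= y -> (y <= x) = false
    by move=> ?; apply/negbTE; rewrite -ltNge; lra.
  by rewrite !F ?ler_nat//=; field.
have [x3|x3] /= := ltP x 3.
  have F y : 3 <= y -> (y <= x) = false
    by move=> ?; apply/negbTE; rewrite -ltNge; lra.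
  by rewrite !F ?ler_nat//=; field.
by have [x4|x4] /= := ltP x 4; field.
Qed.

Let mu := @lebesgue_measure R.

(** Integrating by parts twice against a tent: the second derivative of a tent
    is the combination of point masses with weights 1, -2, 1 (over [h]) at
    [c - h], [c], [c + h].  On each half of the support, where the tent is
    affine of slope [-u / h], an explicit antiderivative is available. *)
Lemma integral_tent_mul c h (G g1 g2 : R -> R) : 0 < h ->
  (forall x, is_derive x 1 G (g1 x)) -> (forall x, is_derive x 1 g1 (g2 x)) ->
  continuous g2 ->
  (\int[mu]_x (tent c h x * g2 x)%:E =
     ((G (c + h) - 2 * G c + G (c - h)) / h)%:E)%E.
Proof.
move=> h0 dG dg1 cg2.
have h00 : h != 0 by rewrite gt_eqF.
have cf : continuous (fun x => tent c h x * g2 x).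
  by move=> x; apply: cvgM; [exact: continuous_tent|exact: cg2].
have mf : measurable_fun setT (EFin \o (fun x => tent c h x * g2 x)).
  by apply/measurable_EFinP; exact: continuous_measurable_fun.
have FTC u (a b : R) : a < b -> u ^+ 2 = 1 ->
    {in `]a, b[, forall x, tent c h x = (h - u * (x - c)) / h} ->
    (\int[mu]_(x in `[a, b]) (tent c h x * g2 x)%:E =
    (((h - u * (b - c)) * g1 b + u * G b) / h)%:E
    - (((h - u * (a - c)) * g1 a + u * G a) / h)%:E)%E.
  move=> ab u2 Hu.
  (* on this half the tent is [(h - u * (x - c)) / h], with [u = 1] or [u = -1] *)
  pose F x := ((h - u * (x - c)) * g1 x + u * G x) / h.
  have dF x : is_derive x 1 F ((h - u * (x - c)) / h * g2 x).
    have D1 : is_derive x 1 (fun x => h - u * (x - c)) (- u).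
      apply: is_derive_eq; rewrite /GRing.scale /=; ring.
    have D2 := is_deriveM D1 (dg1 x).
    have D3 := is_deriveM (is_derive_cst u x 1) (dG x).
    have D4 := is_deriveM (is_deriveD D2 D3) (is_derive_cst h^-1 x 1).
    apply: is_derive_eq D4 _; rewrite /GRing.scale /=; field.
    exact: h00.
  rewrite (@continuous_FTC2 _ (fun x => tent c h x * g2 x) F a b ab)//.
  - exact: continuous_subspaceT.
  - split.
    + by move=> x _; apply: (@ex_derive _ _ _ _ _ _ _ (dF x)).
    + apply: cvg_at_right_filter; apply: differentiable_continuous.
      by apply/derivable1_diffP; apply: (@ex_derive _ _ _ _ _ _ _ (dF a)).
    + apply: cvg_at_left_filter; apply: differentiable_continuous.
      by apply/derivable1_diffP; apply: (@ex_derive _ _ _ _ _ _ _ (dF b)).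
  - move=> x xab; rewrite derive1E; rewrite (@derive_val _ _ _ _ _ _ _ (dF x)).
    by rewrite Hu.
have E u x : h - u > 0 -> `|x - c| = u -> tent c h x = (h - u) / h.
  move=> H xu; rewrite /tent xu mulrBl mulfV// max_r//.
  by rewrite subr_ge0 ler_pdivrMr//; lra.
transitivity (\int[mu]_(x in `[(c - h)%R, c[ `|` `[c, (c + h)%R])
    (tent c h x * g2 x)%:E)%E.
  rewrite [RHS]integral_mkcond; apply: eq_integral => x _ /=.
  rewrite patchE; case: ifPn => //; rewrite notin_setE /= => H.
  rewrite tent_eq0 ?mul0r//.
  rewrite leNgt; apply/negP; rewrite ltr_norml => /andP[x1 x2]; apply: H.
  by rewrite !in_itv /=; have [xc|xc] := ltP x c; [left|right];
    apply/andP; split; lra.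
rewrite integral_setU//; last 2 first.
- exact: measurable_funTS.
- rewrite disj_set2E; apply/eqP; apply/seteqP; split => // x [].
  by rewrite /= !in_itv /= => /andP[_ H] /andP[H' _];
    have := lt_le_trans H H'; rewrite ltxx.
rewrite integral_itv_bndo_bndc; last exact: measurable_funTS.
rewrite (FTC (-1) (c - h)) ?sqrrN ?expr1n//; last 2 first.
- by rewrite gtrBl.
- move=> x; rewrite in_itv /= => /andP[x1 x2].
  by rewrite (E (c - x)); [congr (_ / _); ring|lra|rewrite ler0_norm; lra].
rewrite (FTC 1 c) ?expr1n//; last 2 first.
- by rewrite ltrDl.
- move=> x; rewrite in_itv /= => /andP[x1 x2].
  by rewrite (E (x - c)) ?mul1r//; [lra|rewrite ger0_norm; lra].
by rewrite -!EFinN -!EFinD; congr EFin; field.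
Qed.

(** With a second antiderivative of the second tent, the second difference
    produced by [integral_tent_mul] is a fourth difference of truncated cubes,
    that is, a cubic B-spline. *)
Lemma integral_tent_tent c c' h : 0 < h ->
  (\int[mu]_x (tent c h x * tent c' h x)%:E = (h * B3 (2 + (c - c') / h))%:E)%E.
Proof.
move=> h0; have h00 : h != 0 by rewrite gt_eqF.
(* [D2 n] is the second difference, with step [h], of the truncated power *)
pose D2 n x := posp n (x - c' + h) - 2 * posp n (x - c') + posp n (x - c' - h).
have dD2 n x l : (forall y, is_derive y 1 (posp n.+1) (l * posp n y)) ->
    is_derive x 1 (D2 n.+1) (l * D2 n x).
  move=> dp.
  have dps k : is_derive x 1 (fun y => posp n.+1 (y - c' + k))
      (l * posp n (x - c' + k)).
    have dk : is_derive x 1 (fun y => y - c' + k) 1.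
      by apply: is_derive_eq; rewrite oppr0 !addr0.
    have := @is_derive1_comp _ (posp n.+1) (fun y => y - c' + k) x _ _ (dp _) dk.
    by rewrite mulr1.
  have D0 := dps 0; rewrite addr0 in D0.
  have {}D0 : is_derive x 1 (fun y => posp n.+1 (y - c')) (l * posp n (x - c')).
    by rewrite (_ : (fun _ => _) = (fun y => posp n.+1 (y - c' + 0)))//;
      apply/funext => y; rewrite addr0.
  have := is_deriveD (is_deriveB (dps h)
    (is_deriveM (is_derive_cst (2 : R) x 1) D0)) (dps (- h)).
  move=> D; apply: is_derive_eq D _; rewrite /D2 /GRing.scale /=; ring.
pose G x := D2 3 x * (6 * h)^-1; pose g1 x := D2 2 x * (2 * h)^-1.
have dG x : is_derive x 1 G (g1 x).
  have D := is_deriveM (dD2 2 x 3 is_derive_posp3) (is_derive_cst (6 * h)^-1 x 1).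
  by apply: is_derive_eq D _; rewrite /g1 /GRing.scale /=; field; exact: h00.
have dg1 x : is_derive x 1 g1 (tent c' h x).
  have D := is_deriveM (dD2 1 x 2 is_derive_posp2) (is_derive_cst (2 * h)^-1 x 1).
  apply: is_derive_eq D _; rewrite tent_posp// -/(D2 1 x) /GRing.scale /=.
  by field; exact: h00.
rewrite (integral_tent_mul c h0 dG dg1 (@continuous_tent c' h)) /G.
congr EFin; rewrite B3_posp /D2.
have P (k : R) w : k = h * w -> posp 3 k = h ^+ 3 * posp 3 w.
  by move=> ->; rewrite pospZ.
set w := (c - c') / h.
have cw : c - c' = h * w by rewrite /w; field.
rewrite !(P (c + h - c' + h) (2 + w)); last by rewrite mulrDr -cw; ring.
rewrite !(P (c + h - c') (2 + w - 1)); last by rewrite mulrBr mulrDr -cw; ring.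
rewrite !(P (c + h - c' - h) (2 + w - 2)); last by rewrite mulrBr mulrDr -cw; ring.
rewrite !(P (c - c' + h) (2 + w - 1)); last by rewrite mulrBr mulrDr -cw; ring.
rewrite !(P (c - c') (2 + w - 2)); last by rewrite mulrBr mulrDr -cw; ring.
rewrite !(P (c - c' - h) (2 + w - 3)); last by rewrite mulrBr mulrDr -cw; ring.
rewrite !(P (c - h - c' + h) (2 + w - 2)); last by rewrite mulrBr mulrDr -cw; ring.
rewrite !(P (c - h - c') (2 + w - 3)); last by rewrite mulrBr mulrDr -cw; ring.
rewrite !(P (c - h - c' - h) (2 + w - 4)); last by rewrite mulrBr mulrDr -cw; ring.
by field.
Qed.

(** Both sides are the inner product of two unit tents at distance [x]; swapping
    the factors changes the sign of [x]. *)
Lemma B3_sym x : B3 (2 - x) = B3 (2 + x).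
Proof.
have /eqP := integral_tent_tent 0 x (@ltr01 R).
under eq_integral do rewrite mulrC.
rewrite integral_tent_tent// eqe !mul1r !divr1 sub0r subr0.
by move/eqP.
Qed.

End tent.

(** * Integration on R^d: products and reflections *)

Section lebesgueRd_integral.
Context (R : realType).
Local Notation Rd d := (d.-tuple (measurableTypeR R)).
Local Notation mu := (@lebesgue_measure R).

Lemma integral_lebesgueRdS (d : nat) (F : Rd d.+1 -> \bar R) :
  measurable_fun setT F -> (forall x, 0 <= F x)%E ->
  (\int[lebesgueRd R d.+1]_x F x =
   \int[mu]_t \int[lebesgueRd R d]_x F (tcons (t, x)))%E.
Proof.
move=> mF F0.
have mt := @measurable_tcons R d.
rewrite [LHS](@ge0_integral_pushforward _ _ _ _ _ _ mt
  (@lebesgue_measure R \x lebesgueRd R d)%E) ?preimage_setT//=.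
rewrite -[RHS](@fubini_tonelli1 _ _ _ _ _ mu (lebesgueRd R d) (F \o @tcons R d))//.
  exact: measurableT_comp.
by move=> p; exact: F0.
Qed.

Lemma measurable_prod_tnth d (f : 'I_d -> R -> R) :
  (forall j, measurable_fun setT (f j)) ->
  measurable_fun setT (fun x : Rd d => \prod_(j < d) f j (tnth x j)).
Proof.
move=> mf; apply: measurable_prod => j _.
by apply: measurableT_comp (mf j) _; exact: measurable_tnth.
Qed.

Lemma integral_lebesgueRd_prod d (f : 'I_d -> R -> R) :
  (forall j, measurable_fun setT (f j)) -> (forall j t, 0 <= f j t) ->
  (\int[lebesgueRd R d]_x (\prod_(j < d) f j (tnth x j))%:E =
   \prod_(j < d) \int[mu]_t (f j t)%:E)%E.
Proof.
elim: d f => [|d IH] f mf f0.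
  rewrite big_ord0 /= integral_dirac// ?diracT ?mul1e ?big_ord0//.
  by apply/measurable_EFinP; exact: measurable_prod_tnth.
rewrite integral_lebesgueRdS; last 2 first.
- by apply/measurable_EFinP; exact: measurable_prod_tnth.
- by move=> x; rewrite lee_fin prodr_ge0.
rewrite big_ord_recl -(IH (f \o lift ord0)); last 2 first.
- by move=> j; exact: mf.
- by move=> j; exact: f0.
have I0 : (0 <= \int[lebesgueRd R d]_x (\prod_(j < d) f (lift ord0 j) (tnth x j))%:E)%E.
  by apply: integral_ge0 => x _; rewrite lee_fin prodr_ge0.
rewrite muleC -ge0_integralZl//; last 2 first.
- by apply/measurable_EFinP; exact: mf.
- by move=> t _; rewrite lee_fin.
apply: eq_integral => t _; rewrite muleC -ge0_integralZl//; last 3 first.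
- apply/measurable_EFinP.
  by apply: (@measurable_prod_tnth d (f \o lift ord0)) => j; exact: mf.
- by move=> x _; rewrite lee_fin prodr_ge0// => j _; exact: f0.
- by rewrite lee_fin.
apply: eq_integral => x _; rewrite -EFinM big_ord_recl /=; congr (_ * _)%:E.
by apply: eq_bigr => j _; rewrite /tcons tnthS.
Qed.

Lemma ge0_integral_oppr (f : R -> \bar R) :
  measurable_fun setT f -> (forall t, 0 <= f t)%E ->
  (\int[mu]_t f (- t)%R = \int[mu]_t f t)%E.
Proof.
move=> mf f0.
have mN : measurable_fun setT (-%R : measurableTypeR R -> measurableTypeR R).
  exact: oppr_measurable.
rewrite -[LHS](@ge0_integral_pushforward _ _ _ _ _ _ mN mu setT)//.
apply: eq_measure_integral => A mA _; exact: lebesgue_measureN.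
Qed.

Definition reflect d (e : 'I_d -> bool) (x : Rd d) : Rd d :=
  [tuple (if e j then - (tnth x j : R) else tnth x j) | j < d].

Lemma measurable_reflect d e : measurable_fun setT (@reflect d e).
Proof.
apply/measurable_fun_tnthP => j.
rewrite (_ : _ \o _ = fun x => if e j then - (tnth x j : R) else tnth x j); last first.
  by apply/funext => x; rewrite /= tnth_mktuple.
case: (e j); last exact: measurable_tnth.
by apply: measurableT_comp; [exact: oppr_measurable|exact: measurable_tnth].
Qed.

(** Tonelli peels off one coordinate at a time, so that the invariance of the
    one-dimensional Lebesgue measure under negation suffices. *)
Lemma ge0_integral_reflect d e (F : Rd d -> \bar R) :
  measurable_fun setT F -> (forall x, 0 <= F x)%E ->
  (\int[lebesgueRd R d]_x F (reflect e x) = \int[lebesgueRd R d]_x F x)%E.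
Proof.
elim: d e F => [|d IH] e F mF F0.
  by apply: eq_integral => x _; rewrite [x]tuple0 [reflect _ _]tuple0.
have mFt t : measurable_fun setT (fun x => F (tcons (t, x))).
  apply: measurableT_comp => //.
  by apply: measurableT_comp; [exact: measurable_tcons|exact: measurable_pair1].
rewrite !integral_lebesgueRdS//; last first.
  by apply: measurableT_comp => //; exact: measurable_reflect.
pose K t := (\int[lebesgueRd R d]_x F (tcons (t, x)))%E.
have mK : measurable_fun setT K.
  apply: (@measurable_fun_fubini_tonelli_F _ _ _ _ _ (lebesgueRd R d) (F \o @tcons R d)).
    by apply: measurableT_comp => //; exact: measurable_tcons.
  by move=> p; exact: F0.
have K0 t : (0 <= K t)%E by apply: integral_ge0.
transitivity (\int[mu]_t K (if e ord0 then - t else t)%R)%E.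
  apply: eq_integral => t _; rewrite /K.
  rewrite -(IH (e \o lift ord0) (fun x => F (tcons ((if e ord0 then - t else t), x))))//.
  apply: eq_integral => x _; congr F; apply: eq_from_tnth => j.
  rewrite tnth_mktuple; case: (unliftP ord0 j) => [i|] -> //=.
  by rewrite /tcons !tnthS tnth_mktuple.
by case: (e ord0) => //; rewrite ge0_integral_oppr.
Qed.

(** The integral of a signed function is by definition the difference of the
    integrals of its positive and negative parts, and each of them is
    invariant, be it finite or not. *)
Lemma integral_reflect d e (F : Rd d -> \bar R) : measurable_fun setT F ->
  (\int[lebesgueRd R d]_x F (reflect e x) = \int[lebesgueRd R d]_x F x)%E.
Proof.
move=> mF; rewrite integralE [RHS]integralE; congr (_ - _)%E.
  rewrite -(ge0_integral_reflect e (measurable_funepos mF)); last exact: funepos_ge0.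
  by apply: eq_integral => x _; rewrite -[RHS]/((F^\+ \o reflect e) x)%E -funepos_comp.
rewrite -(ge0_integral_reflect e (measurable_funeneg mF)); last exact: funeneg_ge0.
by apply: eq_integral => x _; rewrite -[RHS]/((F^\- \o reflect e) x)%E -funeneg_comp.
Qed.

End lebesgueRd_integral.

(** * Tensor products of tents *)

Section tensor_tents.
Context (R : realType) (d : nat).
Local Notation Rd := (d.-tuple (measurableTypeR R)).
Local Notation mu := (@lebesgue_measure R).
Local Notation mud := (lebesgueRd R d).
Implicit Types (c : 'I_d -> R) (x s : Rd).

(** Telescoping: the factors are replaced one at a time, and the other factors
    are bounded by 1. *)
Lemma normr_prodB_le n (u v : 'I_n -> R) :
  (forall j, 0 <= u j <= 1) -> (forall j, 0 <= v j <= 1) ->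
  `|\prod_(j < n) u j - \prod_(j < n) v j| <= \sum_(j < n) `|u j - v j|.
Proof.
elim: n u v => [|n IH] u v u01 v01; first by rewrite !big_ord0 subrr normr0.
rewrite !big_ord_recl.
have := IH (u \o lift ord0) (v \o lift ord0) (fun j => u01 _) (fun j => v01 _).
have : 0 <= \prod_(i < n) u (lift ord0 i) <= 1.
  apply/andP; split; last by apply: Num.Theory.prodr_ile1 => j _; exact: u01.
  by apply: prodr_ge0 => j _; have /andP[] := u01 (lift ord0 j).
move: (u01 ord0) (v01 ord0) => /andP[u0 u1] /andP[v0 v1].
set p := \prod_(i < n) u _; set q := \prod_(i < n) v _ => /andP[p0 p1] /= pq.
rewrite (_ : u ord0 * p - v ord0 * q = (u ord0 - v ord0) * p + v ord0 * (p - q));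
  last by ring.
apply: (le_trans (ler_normD _ _)); rewrite !normrM.
apply: lerD; first by rewrite ler_piMr// ger0_norm.
by apply: le_trans pq; rewrite ler_piMl// ger0_norm.
Qed.

Definition tents c (h : R) x : R := \prod_(j < d) tent (c j) h (tnth x j).

Lemma measurable_tents c h : measurable_fun setT (tents c h).
Proof.
by apply: (@measurable_prod_tnth R d (fun j => tent (c j) h)) => j;
  exact: measurable_tent.
Qed.

Lemma tents_tadd c h x s : tents c h (tadd x s) =
  tents (fun j => c j - tnth s j) h x.
Proof. by apply: eq_bigr => j _; rewrite tnth_mktuple tent_shift. Qed.

Lemma tents_support c h x : 0 < h -> tents c h x != 0 ->
  forall j, `|tnth x j - c j| < h.
Proof.
move=> h0 /prodf_neq0 H j; rewrite ltNge; apply/negP => Hj.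
by have := H j isT; rewrite tent_eq0// eqxx.
Qed.

Lemma enorm_ge0 s : 0 <= enorm s.
Proof. exact: sqrtr_ge0. Qed.

Lemma le_enorm s j : `|tnth s j : R| <= enorm s.
Proof.
rewrite -sqrtr_sqr ler_sqrt; last by apply: sumr_ge0 => i _; exact: sqr_ge0.
by rewrite (bigD1 j)//= lerDl sumr_ge0// => i _; exact: sqr_ge0.
Qed.

Lemma enorm_reflect e s : enorm (reflect e s) = enorm s.
Proof.
congr Num.sqrt; apply: eq_bigr => j _; rewrite tnth_mktuple.
by case: (e j); rewrite ?sqrrN.
Qed.

(** Since the increment is of order [enorm s], the product of two increments
    absorbs the singularity of the kernel at the origin. *)
Lemma tents_lipschitz c h x s : 0 < h ->
  `|tents c h (tadd x s) - tents c h x| <= d%:R / h * enorm s.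
Proof.
move=> h0; have B (y : Rd) j : 0 <= tent (c j) h (tnth y j) <= 1.
  by rewrite tent_ge0 tent_le1.
apply: le_trans (normr_prodB_le (B (tadd x s)) (B x)) _.
apply: (@le_trans _ _ (\sum_(j < d) enorm s / h)).
  apply: ler_sum => j _; apply: le_trans (tent_lipschitz _ _ _ h0) _.
  by rewrite ler_pM2r ?invr_gt0// tnth_mktuple addrAC subrr add0r le_enorm.
rewrite sumr_const card_ord (_ : (enorm s / h) *+ d = d%:R / h * enorm s)//.
by rewrite -[LHS]mulr_natl; ring.
Qed.

Lemma integral_tents_mul c c' h : 0 < h ->
  (\int[mud]_x (tents c h x * tents c' h x)%:E =
   (h ^+ d * \prod_(j < d) B3 (2 + (c j - c' j) / h))%:E)%E.
Proof.
move=> h0; under eq_integral do rewrite -big_split /=.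
rewrite (@integral_lebesgueRd_prod R d (fun j t => tent (c j) h t * tent (c' j) h t)).
- under eq_bigr do rewrite integral_tent_tent//.
  by rewrite prodEFin big_split /= prodr_const card_ord.
- by move=> j; apply: measurable_funM; exact: measurable_tent.
- by move=> j t; rewrite mulr_ge0 ?tent_ge0.
Qed.

Lemma integrable_tents_mul c c' h : 0 < h ->
  mud.-integrable setT (fun x => (tents c h x * tents c' h x)%:E).
Proof.
move=> h0; apply/integrableP; split.
  by apply/measurable_EFinP; apply: measurable_funM; exact: measurable_tents.
under eq_integral => x _.
  rewrite abse_EFin ger0_norm; last first.
    by apply: mulr_ge0; apply: prodr_ge0 => j _; exact: tent_ge0.
  over.
by rewrite integral_tents_mul// ltry.
Qed.

Let tents_incrementsE c c' h s :
  let cs := fun j => c j - tnth s j in let c's := fun j => c' j - tnth s j in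
  (fun x => ((tents c h (tadd x s) - tents c h x) *
     (tents c' h (tadd x s) - tents c' h x))%:E) =
  (((fun x => (tents cs h x * tents c's h x)%:E) \+
    (fun x => (tents c h x * tents c' h x)%:E)) \-
   ((fun x => (tents cs h x * tents c' h x)%:E) \+
    (fun x => (tents c h x * tents c's h x)%:E)))%E.
Proof.
move=> cs c's; apply/funext => x /=; rewrite !tents_tadd -/cs -/c's -!EFinD.
by congr EFin; ring.
Qed.

Lemma integrable_tents_increments c c' h s : 0 < h ->
  mud.-integrable setT (fun x => ((tents c h (tadd x s) - tents c h x) *
     (tents c' h (tadd x s) - tents c' h x))%:E).
Proof.
move=> h0; rewrite tents_incrementsE.
by apply: integrableB => //; apply: integrableD => //; exact: integrable_tents_mul.
Qed.

(** The four terms of the expansion all have the form of [integral_tents_mul], since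
    translating a product of tents only moves its centre; the two unmixed ones
    coincide because both centres move by the same vector. *)
Lemma integral_tents_increments c c' h s : 0 < h ->
  (\int[mud]_x ((tents c h (tadd x s) - tents c h x) *
     (tents c' h (tadd x s) - tents c' h x))%:E =
   (h ^+ d * (2 * \prod_(j < d) B3 (2 + (c j - c' j) / h)
     - \prod_(j < d) B3 (2 + (c j - c' j) / h - tnth s j / h)
     - \prod_(j < d) B3 (2 + (c j - c' j) / h + tnth s j / h)))%:E)%E.
Proof.
move=> h0; rewrite tents_incrementsE.
pose cs j := c j - tnth s j; pose c's j := c' j - tnth s j.
have I1 := integrable_tents_mul cs c's h0.
have I2 := integrable_tents_mul c c' h0.
have I3 := integrable_tents_mul cs c' h0.
have I4 := integrable_tents_mul c c's h0.
rewrite integralB//; [|exact: integrableD|exact: integrableD].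
rewrite !integralD// !integral_tents_mul// -!EFinD; congr EFin.
have hh : h != 0 by rewrite gt_eqF.
rewrite (eq_bigr (fun j => B3 (2 + (c j - c' j) / h))); last first.
  by move=> j _; congr (B3 (2 + _ / _)); rewrite /cs /c's; ring.
rewrite [X in _ - (h ^+ d * X + _)](eq_bigr
   (fun j => B3 (2 + (c j - c' j) / h - tnth s j / h))); last first.
  by move=> j _; congr B3; rewrite /cs; field.
rewrite [X in _ - (_ + h ^+ d * X)](eq_bigr
   (fun j => B3 (2 + (c j - c' j) / h + tnth s j / h))); last first.
  by move=> j _; congr B3; rewrite /c's; field.
ring.
Qed.

End tensor_tents.

(** * The radial kernel *)

Section radial_kernel.
Context (R : realType) (d : nat).
Local Notation Rd := (d.-tuple (measurableTypeR R)).
Local Notation mud := (lebesgueRd R d).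

(** Preimages of rays under a monotone function on an interval are intervals. *)
Lemma measurable_nonincreasing_itv (delta : R) (rho : R -> R) :
  {in `]0, delta[ &, {homo rho : r t /~ r <= t}} ->
  measurable_fun `]0, delta[ rho.
Proof.
move=> mono.
apply: (measurability (@RGenCInfty.G R)) => [|/= _ [_] [r] -> <-].
  exact: RGenCInfty.measurableE.
apply: is_interval_measurable => s t /= [s0 rs] [t0 rt] u /andP[su ut].
move: s0 t0 rs rt; rewrite /= !in_itv /= !andbT => /andP[s0 s1] /andP[t0 t1] rs rt.
have ui : 0 < u < delta by rewrite (lt_le_trans s0)// (le_lt_trans ut).
split => //; apply: (le_trans rt); apply: mono; rewrite ?in_itv//=.
by rewrite t0.
Qed.

Lemma measurable_enorm : measurable_fun setT (@enorm R d).
Proof.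
apply: (@measurableT_comp _ _ _ _ _ _ (@Num.sqrt R)).
  by apply: continuous_measurable_fun; exact: sqrt_continuous.
by apply: measurable_sum => j; apply: measurable_funX; exact: measurable_tnth.
Qed.

(** The kernel cut off to the interval where it is monotone, so that it becomes
    a measurable function on the whole space. *)
Definition weight (delta : R) (rho : R -> R) (s : Rd) : R :=
  (rho \_ `]0, delta[) (enorm s).

Lemma measurable_weight delta rho : admissible_kernel d delta rho ->
  measurable_fun setT (weight delta rho).
Proof.
move=> [mono _]; apply: (@measurableT_comp _ _ _ _ _ _ (rho \_ `]0, delta[)) => //.
  apply/(measurable_restrictT _ _).1 => //; exact: measurable_nonincreasing_itv.
exact: measurable_enorm.
Qed.

Lemma weight_eq0 delta rho s : delta <= enorm s -> weight delta rho s = 0.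
Proof.
move=> ds; rewrite /weight patchE memNset//= in_itv /= => /andP[_].
by rewrite ltNge ds.
Qed.

(** Inside the ball the cut-off kernel differs from [rho] at the origin only,
    and there [g] vanishes. *)
Lemma integral_eball delta rho (g : Rd -> R) :
  (forall s, enorm s = 0 -> g s = 0) ->
  (\int[mud]_(s in eball delta) (g s * rho (enorm s))%:E =
   \int[mud]_s (g s * weight delta rho s)%:E)%E.
Proof.
move=> g0; rewrite [LHS]integral_mkcond; apply: eq_integral => s _.
rewrite patchE /weight patchE.
have [s0|s0] := eqVneq (enorm s) 0; first by rewrite g0// !mul0r; case: ifP.
have sp : 0 < enorm s by rewrite lt_neqAle eq_sym s0 enorm_ge0.
have -> : (enorm s \in [set` `]0, delta[]) = (s \in eball delta).
  by apply/idP/idP; rewrite !inE /eball /= in_itv /= sp.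
by case: ifP => // _; rewrite mulr0.
Qed.

(** The kernel may change sign, but an extended-real integral is finite only if
    both its positive and its negative part are, so the finite second moment
    gives absolute integrability. *)
Lemma integrable_weight_sqr delta rho : admissible_kernel d delta rho ->
  mud.-integrable setT (fun s => (enorm s ^+ 2 * weight delta rho s)%:E).
Proof.
move=> adm; have mw := measurable_weight adm.
have mf : measurable_fun setT (fun s : Rd => enorm s ^+ 2 * weight delta rho s).
  by apply: measurable_funM => //; apply: measurable_funX; exact: measurable_enorm.
apply/integrableP; split; first exact/measurable_EFinP.
rewrite integral_fin_num_abs// -integral_eball; last first.
  by move=> s ->; rewrite expr0n.
have [_] := adm.
by under eq_integral do rewrite mulrC; move=> ->.
Qed.

End radial_kernel.

(** * The nonlocal form on tensor products of tents *)

Section nonlocal_form_of_tents.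
Context (R : realType) (d : nat).
Local Notation Rd := (d.-tuple (measurableTypeR R)).
Local Notation mud := (lebesgueRd R d).
Implicit Types (c : 'I_d -> R) (x s : Rd).

Lemma measurable_B3 : measurable_fun setT (@B3 R).
Proof.
have mp : measurable_fun setT (@posp R 3).
  apply: continuous_measurable_fun => x.
  apply: differentiable_continuous; apply/derivable1_diffP.
  exact: (@ex_derive _ _ _ _ _ _ _ (is_derive_posp3 x)).
have mpk k : measurable_fun setT (fun x : R => posp 3 (x - k)).
  by apply: measurableT_comp => //; exact: measurable_funB.
rewrite (_ : @B3 R = fun t => (posp 3 t - 4 * posp 3 (t - 1) + 6 * posp 3 (t - 2)
  - 4 * posp 3 (t - 3) + posp 3 (t - 4)) / 6);
  last by apply/funext => t; exact: B3_posp.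
by do ![apply: measurable_funM => //|apply: measurable_funD => //
  |apply: measurableT_comp => //|exact: mpk].
Qed.

Lemma measurable_f_spline (h : R) (k : 'I_d -> nat) :
  measurable_fun setT (@f_spline R d h k).
Proof.
have mS (sg : R -> R) : measurable_fun setT sg ->
    measurable_fun setT (fun s : Rd =>
      \prod_(j < d) B3 ((k j)%:R + 2 + sg (tnth s j / h))).
  move=> msg.
  apply: (@measurable_prod_tnth R d (fun j t => B3 ((k j)%:R + 2 + sg (t / h)))) => j.
  apply: measurableT_comp; first exact: measurable_B3.
  apply: measurable_funD => //; apply: measurableT_comp => //.
  exact: measurable_funM.
apply: measurable_funB; last exact: (mS id).
apply: measurable_funB => //; exact: (mS -%R).
Qed.

Lemma measurable_tadd :
  measurable_fun setT (fun p : Rd * Rd => tadd p.2 p.1).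
Proof.
apply/measurable_fun_tnthP => j.
rewrite (_ : _ \o _ = fun p : Rd * Rd => tnth p.2 j + tnth p.1 j : R); last first.
  by apply/funext => p; rewrite /= tnth_mktuple.
apply: measurable_funD.
  by apply: (measurableT_comp (measurable_tnth j)) => //; exact: measurable_snd.
by apply: (measurableT_comp (measurable_tnth j)) => //; exact: measurable_fst.
Qed.

Lemma enlarged_box_finite (a b : 'I_d -> R) delta :
  measurable (enlarged_box a b delta) /\ (mud (enlarged_box a b delta) < +oo)%E.
Proof.
have E : enlarged_box a b delta =
    [set x : Rd | forall j, `]a j - delta, b j + delta[%classic (tnth x j)].
  by apply/seteqP; split => x /= H j; have := H j; rewrite in_itv.
split.
  rewrite E (_ : mkset _ =
      \bigcap_(j in [set` [set: 'I_d]%SET])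
        ((tnth (T:=_))^~ j @^-1` `]a j - delta, b j + delta[%classic)).
    apply: fin_bigcap_measurable => // j _.
    by rewrite -[X in measurable X]setTI; apply: measurable_tnth => //;
      exact: measurable_itv.
  apply/seteqP; split => x /= Ax j => [_|]; first exact: Ax.
  by apply: Ax; rewrite /= inE.
rewrite E (@lebesgueRd_box R d (fun j => `]a j - delta, b j + delta[%classic)); last first.
  by move=> j; exact: measurable_itv.
rewrite ltey_eq; apply/orP; left.
apply: (big_ind (fun y : \bar R => y \is a fin_num)) => //.
  by move=> u v; exact: fin_numM.
by move=> j _; rewrite lebesgue_measure_itv; case: ifP.
Qed.

(** The hypothesis of Fubini.  By [tents_lipschitz] the integrand is at most
    [K * enorm s ^+ 2 * `|weight delta rho s|], and for [s] in the ball of radius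
    [delta] it vanishes unless [x] lies in the set [D] of finite measure. *)
Lemma integrable_increments c c' (h delta : R) rho (D : set Rd) :
  0 < h -> admissible_kernel d delta rho ->
  measurable D -> (mud D < +oo)%E ->
  (forall x s, enorm s < delta -> tents c h (tadd x s) != tents c h x -> D x) ->
  (mud \x mud)%E.-integrable setT (EFin \o (fun p : Rd * Rd =>
    (tents c h (tadd p.2 p.1) - tents c h p.2) *
     (tents c' h (tadd p.2 p.1) - tents c' h p.2) * weight delta rho p.1)).
Proof.
move=> h0 adm mD Dfin suppD.
have mw := measurable_weight adm.
have mincr (e : 'I_d -> R) : measurable_fun setT
    (fun p : Rd * Rd => tents e h (tadd p.2 p.1) - tents e h p.2).
  apply: measurable_funB.
    by apply: measurableT_comp measurable_tadd; exact: measurable_tents.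
  by apply: measurableT_comp measurable_snd; exact: measurable_tents.
set F := (fun p : Rd * Rd => _ * weight delta rho p.1).
have mF : measurable_fun setT F.
  apply: measurable_funM; first exact: measurable_funM.
  by apply: (measurableT_comp mw); exact: measurable_fst.
apply/integrable12ltyP; first exact/measurable_EFinP.
pose q s : R := enorm s ^+ 2 * weight delta rho s.
pose K : R := (d%:R / h) ^+ 2.
have K0 : 0 <= K by exact: sqr_ge0.
have /integrableP[/measurable_EFinP mq iq] := integrable_weight_sqr adm.
have Dnum : mud D \is a fin_num by rewrite ge0_fin_numE.
apply: (@le_lt_trans _ _ (\int[mud]_s ((K * fine (mud D))%:E * `|(q s)%:E|))%E); last first.
  rewrite ge0_integralZl//.
  - by rewrite lte_mul_pinfty// lee_fin mulr_ge0// fine_ge0.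
  - by do 2 apply: measurableT_comp => //.
  - by rewrite lee_fin mulr_ge0// fine_ge0.
apply: ge0_le_integral => //.
- by move=> s _; apply: integral_ge0.
- apply: (@measurable_fun_fubini_tonelli_F _ _ _ _ _ mud (fun p => `|(F p)%:E|)%E) => //.
  by do 2 apply: measurableT_comp => //.
- by apply: measurable_funeM; do 2 apply: measurableT_comp => //.
move=> s _ /=.
rewrite (_ : ((K * fine (mud D))%:E * `|(q s)%:E| =
    \int[mud]_(x in D) (K * `|q s|)%:E)%E); last first.
  by rewrite integral_cst// EFinM fineK// abse_EFin EFinM muleAC.
rewrite [leRHS]integral_mkcond; apply: ge0_le_integral => //.
- apply/measurable_EFinP; apply: measurableT_comp => //.
  exact: (measurableT_comp mF (measurable_pair1 s)).
- by apply/(measurable_restrictT _ _).1.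
move=> x _; rewrite patchE.
have [ds|sd] := leP delta (enorm s).
  rewrite /F /= weight_eq0// mulr0 normr0.
  by case: ifP => //; rewrite lee_fin mulr_ge0.
case: ifPn => [_|xD]; last first.
  have [ne0|ne] := eqVneq (tents c h (tadd x s)) (tents c h x).
    by rewrite /F /= ne0 subrr !mul0r normr0.
  by move/negP: xD; rewrite inE => -[]; exact: suppD ne.
have -> : `|q s| = enorm s ^+ 2 * `|weight delta rho s|.
  by rewrite /q normrM normrX (ger0_norm (enorm_ge0 s)).
rewrite lee_fin /F /K mulrA -exprMn expr2.
apply: (@le_trans _ _ (`|tents c h (tadd x s) - tents c h x| *
    `|tents c' h (tadd x s) - tents c' h x| * `|weight delta rho s|)).
  by rewrite -!normrM.
by apply: ler_wpM2r => //; apply: ler_pM => //; exact: tents_lipschitz.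
Qed.

(** Exchanging the two integrals leaves, for each [s], the integral over [x] of
    a product of increments.  By the support condition on [c] a point [x]
    outside of the enlarged box stays outside of the support of [tents c h] when
    it is moved by less than [delta], so the integral over that box is the
    integral over the whole space. *)
Lemma nonlocal_form_tents c c' (a b : 'I_d -> R) (h delta : R) rho :
  0 < h -> admissible_kernel d delta rho ->
  (forall j t, `|t - c j| < h -> a j < t < b j) ->
  let f s := 2 * \prod_(j < d) B3 (2 + (c j - c' j) / h)
     - \prod_(j < d) B3 (2 + (c j - c' j) / h - tnth s j / h)
     - \prod_(j < d) B3 (2 + (c j - c' j) / h + tnth s j / h) in
  mud.-integrable setT (fun s => (f s * weight delta rho s)%:E) /\
  (nonlocal_form a b delta rho (tents c h) (tents c' h) =
   (h ^+ d / 2)%:E * \int[mud]_s (f s * weight delta rho s)%:E)%E.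
Proof.
move=> h0 adm csupp f.
have [mD Dfin] := enlarged_box_finite a b delta.
set D := enlarged_box a b delta in mD Dfin *.
have suppD x s : enorm s < delta -> tents c h (tadd x s) != tents c h x -> D x.
  move=> sd; have [xs0 ne j|xs0 _ j] := eqVneq (tents c h (tadd x s)) 0.
    have /(tents_support h0)/(_ j)/csupp/andP[x1 x2] : tents c h x != 0.
      by rewrite -xs0 eq_sym.
    have := le_lt_trans (enorm_ge0 s) sd; lra.
  have := csupp _ _ (tents_support h0 xs0 j).
  rewrite tnth_mktuple => /andP[x1 x2].
  have := le_lt_trans (le_enorm s j) sd; rewrite ltr_norml => /andP[? ?]; lra.
pose F (p : Rd * Rd) := (tents c h (tadd p.2 p.1) - tents c h p.2) *
     (tents c' h (tadd p.2 p.1) - tents c' h p.2) * weight delta rho p.1.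
have iF : (mud \x mud)%E.-integrable setT (EFin \o F).
  exact: integrable_increments suppD.
have FE s : (\int[mud]_x (F (s, x))%:E =
    (h ^+ d)%:E * (f s * weight delta rho s)%:E)%E.
  transitivity (\int[mud]_x ((weight delta rho s)%:E *
      ((tents c h (tadd x s) - tents c h x) * (tents c' h (tadd x s) - tents c' h x))%:E))%E.
    by apply: eq_integral => x _; rewrite -EFinM mulrC.
  rewrite integralZl//; last exact: integrable_tents_increments.
  rewrite integral_tents_increments// -!EFinM; congr EFin.
  by rewrite -/(f s); ring.
have hd0 : h ^+ d != 0 by rewrite expf_neq0// gt_eqF.
have if_ : mud.-integrable setT (fun s => (f s * weight delta rho s)%:E).
  have := integrable_fubini_F iF.
  move/(integrableZl measurableT (h ^+ d)^-1).
  congr integrable; apply/funext => s; rewrite /fubini_F FE -!EFinM.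
  by rewrite mulKf.
split=> //; rewrite /nonlocal_form.
rewrite (_ : (\int[mud]_(x in D) _)%E =
    (h ^+ d)%:E * \int[mud]_s (f s * weight delta rho s)%:E)%E; last first.
  rewrite -integralZl//; under [RHS]eq_integral do rewrite -FE.
  rewrite (Fubini iF) integral_mkcond; apply: eq_integral => x _ /=.
  have -> : (\int[mud]_s (F (s, x))%:E = \int[mud]_(s in eball delta)
    ((tents c h (tadd x s) - tents c h x) * (tents c' h (tadd x s) - tents c' h x)
      * rho (enorm s))%:E)%E.
    rewrite integral_eball// => s s0.
    have -> : tadd x s = x; last by rewrite subrr mul0r.
    apply: eq_from_tnth => j; rewrite tnth_mktuple.
    have := le_enorm s j; rewrite s0 normr_le0 => /eqP ->.
    by rewrite addr0.
  rewrite patchE; case: ifPn => // xD.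
  rewrite integral0_eq// => s /= sd.
  have [->|ne] := eqVneq (tents c h (tadd x s)) (tents c h x).
    by rewrite subrr !mul0r.
  by move/negP: xD; rewrite inE => -[]; exact: suppD ne.
by rewrite muleA -EFinM mulrC.
Qed.

End nonlocal_form_of_tents.

(** * From signed to absolute index differences *)

Section signed_spline.
Context (R : realType) (d : nat).
Local Notation Rd := (d.-tuple (measurableTypeR R)).

Lemma fe_basis_tents (a : 'I_d -> R) (h : R) (n : 'I_d -> nat) :
  0 < h -> (forall j, (0 < n j)%N) ->
  fe_basis a h n = tents (fun j => grid_point (a j) h (n j)) h.
Proof.
move=> h0 n0; apply/funext => x.
by apply: eq_bigr => j _; exact: hat_tent.
Qed.

(** In the coordinates where [n j < m j], the symmetry of the B-spline trades
    the sign of [n j - m j] for that of [tnth s j]. *)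
Lemma f_spline_reflect (h : R) (n m : 'I_d -> nat) (s : Rd) :
  f_spline h (fun j => `|(n j)%:Z - (m j)%:Z|%N)
     (reflect (fun j => (n j < m j)%N) s) =
  2 * \prod_(j < d) B3 (2 + ((n j)%:R - (m j)%:R))
     - \prod_(j < d) B3 (2 + ((n j)%:R - (m j)%:R) - tnth s j / h)
     - \prod_(j < d) B3 (2 + ((n j)%:R - (m j)%:R) + tnth s j / h).
Proof.
have K j : (`|(n j)%:Z - (m j)%:Z|%N)%:R =
    if (n j < m j)%N then (m j)%:R - (n j)%:R else (n j)%:R - (m j)%:R :> R.
  case: ltnP => nm; first by rewrite distnC distnEl ?natrB// ltnW.
  by rewrite distnEl ?natrB.
have S (x y : R) : x + y = 4 -> B3 x = B3 y.
  move=> xy; rewrite (_ : x = 2 - (2 - x)); last by ring.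
  by rewrite B3_sym; congr B3; lra.
rewrite /f_spline; congr (2 * _ - _ - _); apply: eq_bigr => j _;
  rewrite K ?tnth_mktuple; case: ifP => _; by [apply: S; ring|congr B3; ring].
Qed.

Lemma f_spline0 (h : R) (k : 'I_d -> nat) (s : Rd) : enorm s = 0 -> f_spline h k s = 0.
Proof.
move=> s0; rewrite /f_spline.
have sj j : tnth s j = 0 :> R.
  by have := le_enorm s j; rewrite s0 normr_le0 => /eqP.
rewrite [X in _ - X - _](eq_bigr (fun j => B3 ((k j)%:R + 2))); last first.
  by move=> j _; rewrite sj mul0r subr0.
rewrite [X in _ - _ - X](eq_bigr (fun j => B3 ((k j)%:R + 2))); last first.
  by move=> j _; rewrite sj mul0r addr0.
ring.
Qed.

End signed_spline.

Theorem theorem1 (R : realType) (d : nat) (a b : 'I_d -> R) (N : 'I_d -> nat)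
    (h delta : R) (rho : R -> R)
    (d_gt0 : (0 < d)%N)
    (ab : forall j, a j < b j)
    (N_ge1 : forall j, (1 <= N j)%N)
    (h_def : forall j, (b j - a j) / (N j + 1)%:R = h)
    (delta_gt0 : 0 < delta)
    (rho_adm : admissible_kernel d delta rho)
    (n m : 'I_d -> nat) (hn : multi_index N n) (hm : multi_index N m) :
  let k := fun j => `|(n j)%:Z - (m j)%:Z|%N in
  ((stiffness a b N h delta rho (global_ord hn) (global_ord hm))%:E
    = nonlocal_form a b delta rho (fe_basis a h n) (fe_basis a h m)
   /\
   nonlocal_form a b delta rho (fe_basis a h n) (fe_basis a h m)
    = (h ^+ d / 2)%:E *
      \int[lebesgueRd R d]_(s in eball delta)
        (f_spline h k s * rho (enorm s))%:E)%E.
Proof.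
move=> k.
have h0 : 0 < h.
  by rewrite -(h_def (Ordinal d_gt0)) divr_gt0 ?subr_gt0// ltr0n addn1.
have n0 j : (0 < n j)%N by have /andP[] := hn j.
have m0 j : (0 < m j)%N by have /andP[] := hm j.
pose c j := grid_point (a j) h (n j); pose c' j := grid_point (a j) h (m j).
(* a basis function is supported in the original box since [1 <= n j <= N j] *)
have csupp j t : `|t - c j| < h -> a j < t < b j.
  have bE : b j = a j + (N j)%:R * h + h.
    have := h_def j; move=> /(congr1 ( *%R^~ (N j + 1)%:R)).
    rewrite divfK; last by rewrite pnatr_eq0 addn1.
    by rewrite natrD; lra.
  rewrite ltr_norml /c /grid_point => /andP[t1 t2].
  have /andP[n1 nN] := hn j.
  have H1 : 1 * h <= (n j)%:R * h by rewrite ler_pM2r// ler1n.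
  have H2 : (n j)%:R * h <= (N j)%:R * h by rewrite ler_pM2r// ler_nat.
  rewrite bE; apply/andP; split; lra.
have [] := @nonlocal_form_tents R d c c' a b h delta rho h0 rho_adm csupp.
rewrite -!fe_basis_tents// => intf E.
split.
  rewrite /stiffness mxE !local_global_index//= E fineK// fin_numM//.
  exact: integrable_fin_num.
rewrite E; congr (_ * _)%E.
have w_reflect (e : 'I_d -> bool) s : weight delta rho (reflect e s) = weight delta rho s.
  by rewrite /weight enorm_reflect.
(* the two sides differ by a reflection, which preserves ball, kernel and measure *)
rewrite integral_eball; last exact: f_spline0.
rewrite -[RHS](integral_reflect (fun j => (n j < m j)%N)); last first.
  apply/measurable_EFinP.
  exact: measurable_funM (measurable_f_spline h k) (measurable_weight rho_adm).
apply: eq_integral => s _; rewrite f_spline_reflect w_reflect; congr (_ * _)%:E.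
have cc j : (c j - c' j) / h = (n j)%:R - (m j)%:R.
  by rewrite /c /c' /grid_point; field; rewrite gt_eqF.
by under eq_bigr do rewrite cc; under [X in _ - X - _]eq_bigr do rewrite cc;
  under [X in _ - _ - X]eq_bigr do rewrite cc.
Qed.
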